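(* Let $T:\mathcal H\rightrightarrows\mathcal H$ be maximal monotone, and suppose that there exists $(\bar z_*,\bar w_* )\in\operatorname{gph}T_*$ such that $T_{**}(\bar z_*,\bar w_* )$ is bounded. Then: (i) for every $(z_*,w_* )\in\operatorname{gph}T_*$, the completion fiber $T_{**}(z_*,w_* )$ is a nonempty compact convex subset of $H_{**}$; (ii) $T_{**}$ is locally bounded on its domain; (iii) $T_*$ is maximal monotone on $H_*$.
   Context: $\mathcal H$ is a finite-dimensional Hilbert space with an orthogonal decomposition $\mathcal H=H_*\oplus H_{**}$ into subspaces; each $z\in\mathcal H$ is written $z=(z_*,z_{**})$ with $z_*\in H_*$, $z_{**}\in H_{**}$ its orthogonal components. The projected mapping $T_*:H_*\rightrightarrows H_*$ and the completion mapping $T_{**}:H_*\times H_*\rightrightarrows H_{**}$ are defined by $$w_*\in T_*(z_* )\iff\exists z_{**}\in H_{**}\text{ such that }(w_*,0)\in T(z_*,z_{**}),$$ $$T_{**}(z_*,w_* ):=\{z_{**}\in H_{**}\mid(w_*,0)\in T(z_*,z_{**})\}.$$ A set-valued mapping $F:X\rightrightarrows Y$ between finite-dimensional Hilbert spaces is locally bounded at $\bar x\in\operatorname{dom}F$ if $\bigcup_{x\in U\cap\operatorname{dom}F}F(x)$ is bounded for some neighborhood $U$ of $\bar x$; it is locally bounded on its domain if this holds at every point of $\operatorname{dom}F$. *)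

(* Defs.v *)
From HB Require Import structures.
From mathcomp Require Import all_boot all_order all_algebra.
From mathcomp Require Import sesquilinear.
From mathcomp Require Import all_classical all_reals all_analysis.
From mathcomp Require Import ring lra.

Set Implicit Arguments.
Unset Strict Implicit.
Unset Printing Implicit Defensive.

Import Order.TTheory GRing.Theory Num.Theory.
Import numFieldNormedType.Exports.

Local Open Scope classical_set_scope.
Local Open Scope ring_scope.

(* Real finite-dimensional Hilbert spaces: the norm, and hence the topology, is
   the one of the inner product.  Completeness is automatic in finite
   dimension. *)
HB.mixin Record NormedModule_isFinHilbert (R : realType) H
    & NormedModule R H & Vector R H := {
  dotp : {dot H for idfun : R -> R} ;
  norm_dotp : forall x : H, `|x| = Num.sqrt (dotp x x)
}.

#[short(type="finHilbertType")]
HB.structure Definition FinHilbert (R : realType) :=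
  {H of NormedModule R H & Vector R H & NormedModule_isFinHilbert R H}.

Notation "''[' u , v ]" := (dotp u v) : ring_scope.

(* Any finite-dimensional real vector space with an inner product becomes a
   [finHilbertType]. *)
HB.factory Record Vector_isFinHilbert (R : realType) H & Vector R H := {
  form : {dot H for idfun : R -> R}
}.

HB.builders Context R H & Vector_isFinHilbert R H.

Let form_ge0 (x : H) : 0 <= form x x.
Proof.
have [->|x0] := eqVneq x 0; first by rewrite linear0r.
by rewrite ltW// neq0_dnorm_gt0.
Qed.

Let formC (x y : H) : form x y = form y x.
Proof. by rewrite hermC expr0 mul1r. Qed.

Let formDD (x y : H) : form (x + y) (x + y) = form x x + form x y *+ 2 + form y y.
Proof. rewrite linearDl !linearDr /= (formC y x); ring. Qed.

Let cauchy_schwarz (x y : H) : form x y ^+ 2 <= form x x * form y y.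
Proof.
have [->|y0] := eqVneq y 0; first by rewrite linear0r expr0n mulr_ge0.
have c0 : 0 < form y y by rewrite neq0_dnorm_gt0.
have := form_ge0 (form y y *: x - form x y *: y).
rewrite linearBl !linearBr /= !linearZl_LR /= !linearZr_LR /= (formC y x).
move=> h; rewrite -subr_ge0 -(pmulr_rge0 _ c0); move: h; congr (0 <= _).
by rewrite /GRing.scale /=; ring.
Qed.

Let norm (x : H) : R := Num.sqrt (form x x).

Let ler_normD (x y : H) : norm (x + y) <= norm x + norm y.
Proof.
have n0 : 0 <= norm x + norm y by rewrite addr_ge0 ?sqrtr_ge0.
rewrite /norm -(ger0_norm n0) -sqrtr_sqr ler_wsqrtr// formDD sqrrD.
rewrite !sqr_sqrtr ?form_ge0// lerD2r lerD2l lerMn2r /=.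
rewrite -sqrtrM ?form_ge0//; apply: le_trans (ler_norm _) _.
by rewrite -sqrtr_sqr ler_wsqrtr// cauchy_schwarz.
Qed.

Let normrZ (l : R) (x : H) : norm (l *: x) = `|l| * norm x.
Proof.
rewrite /norm linearZl_LR linearZr_LR /= mulrA -expr2.
by rewrite sqrtrM ?sqr_ge0// sqrtr_sqr.
Qed.

Let normr0_eq0 (x : H) : norm x = 0 -> x = 0.
Proof.
move=> /eqP; rewrite /norm sqrtr_eq0 => h.
by apply/eqP/contraT => /(neq0_dnorm_gt0 (s := form)); rewrite ltNge h.
Qed.

HB.instance Definition _ := Lmodule_isNormed.Build R H ler_normD normrZ normr0_eq0.

HB.instance Definition _ :=
  NormedModule_isFinHilbert.Build R H (dotp := form) (fun=> erefl).

HB.end.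

Section subspace_dotp.
Context {R : realType} {H : finHilbertType R} (U : {vspace H}).

Definition sub_dotp (u v : subvs_of U) : R := '[vsval u, vsval v].

Let sub_dotp_linearl (v : subvs_of U) : linear_for *%R (sub_dotp^~ v).
Proof. by move=> a x y; rewrite /sub_dotp linearP linearPl. Qed.

Let sub_dotp_linearr (u : subvs_of U) : linear_for *%R (sub_dotp u).
Proof. by move=> a x y; rewrite /sub_dotp !linearP. Qed.

Let sub_dotp_sym (u v : subvs_of U) :
  sub_dotp u v = (-1) ^+ false * idfun (sub_dotp v u).
Proof. exact: hermC. Qed.

Let sub_dotp_gt0 (u : subvs_of U) : u != 0 -> 0 < sub_dotp u u.
Proof. by move=> u0; apply: neq0_dnorm_gt0. Qed.

HB.instance Definition _ := bilinear_isBilinear.Build R (subvs_of U) (subvs_of U)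
  R *%R (idfun \; *%R) sub_dotp (conj sub_dotp_linearl sub_dotp_linearr).
HB.instance Definition _ := isHermitianSesquilinear.Build R (subvs_of U)
  false idfun sub_dotp sub_dotp_sym.
HB.instance Definition _ :=
  isDotProduct.Build R (subvs_of U) sub_dotp sub_dotp_gt0.

End subspace_dotp.

HB.instance Definition _ (R : realType) (H : finHilbertType R) (U : {vspace H}) :=
  Vector_isFinHilbert.Build R (subvs_of U) (sub_dotp (U := U)).

Section set_valued.

Definition gph (X Y : Type) (F : X -> set Y) : set (X * Y) :=
  [set p | F p.1 p.2].

Definition dom (X Y : Type) (F : X -> set Y) : set X := [set x | F x !=set0].

Definition locally_bounded_at (R : realType) (X : topologicalType)
    (Y : normedModType R) (F : X -> set Y) (x : X) : Prop :=
  exists2 U : set X, nbhs x U & bounded_set (\bigcup_(y in U `&` dom F) F y).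

Definition locally_bounded_on_dom (R : realType) (X : topologicalType)
    (Y : normedModType R) (F : X -> set Y) : Prop :=
  forall x, dom F x -> locally_bounded_at F x.

End set_valued.

Section monotone.
Context {R : realType} {H : finHilbertType R}.

Definition monotone (T : H -> set H) : Prop :=
  forall x y u v : H, T x u -> T y v -> 0 <= '[x - y, u - v].

Definition maximal_monotone (T : H -> set H) : Prop :=
  monotone T /\
  forall S : H -> set H, monotone S -> gph T `<=` gph S -> gph S = gph T.

End monotone.

Section decomposition.
Context {R : realType} {H : finHilbertType R} (U V : {vspace H}).

Definition orthogonal_decomposition : Prop :=
  {in U & V, forall u v, '[u, v] = 0} /\ (U + V)%VS = fullv.

(* The vector of H with H_star-component zs and H_starstar-component zss. *)
Definition of_components (zs : subvs_of U) (zss : subvs_of V) : H :=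
  vsval zs + vsval zss.

Definition projected_map (T : H -> set H) (zs : subvs_of U) :
    set (subvs_of U) :=
  [set ws | exists zss : subvs_of V, T (of_components zs zss) (of_components ws 0)].

(* The pair space U * U carries the product topology (max norm), which is the
   topology of its product Hilbert structure. *)
Definition completion_map (T : H -> set H) (p : subvs_of U * subvs_of U) :
    set (subvs_of V) :=
  [set zss | T (of_components p.1 zss) (of_components p.2 0)].

End decomposition.

Arguments projected_map {R H} U V T zs _.
Arguments completion_map {R H} U V T p _.

(* Main.v *)
(** Write [(c, d)] in [T(a, b)] for the graph of [T] in the decomposition.  The
    projected map is maximal monotone as soon as every [v] has some [a] such
    that [v - a] lies in the image of [a].  A Minty-type theorem gives
    approximate solutions [(v - a, - eps b)] in [T(a, b)], and one passes to the
    limit [eps -> 0].  Compactness comes from the recession cone: all the fibers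
    of the completion map have the same one, the polar cone of the set of all
    [d] with [(c, d)] in the range of [T], so one bounded fiber makes it
    trivial.  A single estimate then bounds [b] in terms of [a] and [c],
    uniformly in [eps]; its case [eps = 0] is the boundedness of the completion
    map on bounded sets.
    Minty's theorem itself is obtained by minimizing a convex quadratic over
    the convex hull of the triples [(y, w, '[y, w])], [w] in [T(y)]. *)
Require Import Defs.
From mathcomp Require Import all_boot all_order all_algebra.
From mathcomp Require Import sesquilinear.
From mathcomp Require Import all_classical all_reals all_analysis.
From mathcomp Require Import ring lra.

Set Implicit Arguments.
Unset Strict Implicit.
Unset Printing Implicit Defensive.

Import Order.TTheory GRing.Theory Num.Theory.
Import VectorInternalTheory.
Import numFieldNormedType.Exports.

Local Open Scope classical_set_scope.
Local Open Scope ring_scope.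

(** * Inner products and compactness of closed balls *)

Lemma closed_norm_preimage {R : realType} {V : normedModType R} (D : set R) :
  closed D -> closed [set v : V | D `|v|].
Proof.
by move=> cD; apply: (proj1 (continuous_closedP _) (@norm_continuous R V)).
Qed.

Section dotp_theory.
Context {R : realType} {H : finHilbertType R}.
Implicit Types x y z : H.

Lemma dotpC x y : '[x, y] = '[y, x].
Proof. by rewrite hermC expr0 mul1r. Qed.

Lemma dotpDl x y z : '[x + y, z] = '[x, z] + '[y, z].
Proof. exact: linearDl. Qed.

Lemma dotpDr x y z : '[x, y + z] = '[x, y] + '[x, z].
Proof. exact: linearDr. Qed.

Lemma dotpZl a x y : '[a *: x, y] = a * '[x, y].
Proof. exact: linearZl_LR. Qed.

Lemma dotpZr a x y : '[x, a *: y] = a * '[x, y].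
Proof. by rewrite dotpC dotpZl dotpC. Qed.

Lemma dotpNl x y : '[- x, y] = - '[x, y].
Proof. by rewrite -scaleN1r dotpZl mulN1r. Qed.

Lemma dotpNr x y : '[x, - y] = - '[x, y].
Proof. by rewrite -scaleN1r dotpZr mulN1r. Qed.

Lemma dotp0l x : '[0, x] = 0.
Proof. by rewrite -(scale0r x) dotpZl mul0r. Qed.

Lemma dotp0r x : '[x, 0] = 0.
Proof. by rewrite dotpC dotp0l. Qed.

Definition dotpE := (dotpDl, dotpDr, dotpNl, dotpNr, dotpZl, dotpZr,
  dotp0l, dotp0r).

Lemma dotp_ge0 x : 0 <= '[x, x].
Proof.
have [->|x0] := eqVneq x 0; first by rewrite dotp0l.
exact/ltW/neq0_dnorm_gt0.
Qed.

Lemma dotpp x : '[x, x] = `|x| ^+ 2.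
Proof. by rewrite norm_dotp sqr_sqrtr// dotp_ge0. Qed.

Lemma dotp_le x y : '[x, y] <= `|x| * `|y|.
Proof.
have : `|x + y| ^+ 2 <= (`|x| + `|y|) ^+ 2.
  by rewrite lerXn2r ?nnegrE ?addr_ge0// ler_normD.
rewrite -dotpp !dotpE !dotpp (dotpC y x); lra.
Qed.

Lemma dotp_cvg (T : Type) (F : set_system T) (FF : Filter F)
    (f g : T -> H) a b :
  f @ F --> a -> g @ F --> b -> (fun t => '[f t, g t]) @ F --> '[a, b].
Proof.
have polar x y : '[x, y] = 4^-1 * (`|x + y| ^+ 2 - `|x - y| ^+ 2).
  by rewrite -!dotpp !dotpE (dotpC y x); field.
move=> fa gb; under eq_cvg do rewrite polar.
rewrite polar; apply: cvgMl_tmp; apply: cvgB; rewrite expr2;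
  under eq_cvg do rewrite expr2.
  by apply: cvgM; apply: cvg_norm; apply: cvgD.
by apply: cvgM; apply: cvg_norm; apply: cvgB.
Qed.

(** The ball is a closed subset of the image, under the coordinate map [r2v], of a compact ball of
    row vectors. *)
Lemma closed_ball_compact (M : R) : compact [set x : H | `|x| <= M].
Proof.
pose n := dim H; pose g : 'rV[R]_n -> H := r2v.
have gZ a v : g (a *: v) = a *: g v by exact: linearZ_LR.
have gcont : continuous g.
  have gE : g = fun v => \sum_(i < n) v ord0 i *: g (delta_mx 0 i).
    apply/funext => v; rewrite [in LHS](row_sum_delta v) /g linear_sum.
    exact: eq_bigr.
  rewrite gE; apply: continuous_big; first exact: add_continuous.
  move=> i _ v; apply: cvgZr_tmp.
    exact: (nbhs_filter v).
  exact: (@coord_continuous R 1 n ord0 i v).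
have sphere_compact : compact [set v : 'rV[R]_n | `|v| = 1].
  apply: bounded_closed_compact.
    by exists 1; split=> // r r1 v /= ->; exact: ltW.
  exact: (@closed_norm_preimage R 'rV[R]_n [set x | x = 1] (@closed_eq _ 1)).
(* [c] is the minimum of [|g v|] on the unit sphere, positive because [g] is injective. In dimension
   0 the sphere is empty and any [c] works. *)
have [c c0 cg] : exists2 c : R, 0 < c & forall v, c * `|v| <= `|g v|.
  have unit (v : 'rV[R]_n) : v != 0 -> `| `|v|^-1 *: v | = 1.
    by move=> v0; rewrite normrZ ger0_norm ?invr_ge0// mulVf ?normr_eq0.
  have [S0|/set0P/negP/negPn/eqP S0] :=
    pselect ([set v : 'rV[R]_n | `|v| = 1] !=set0).
    have [|v0] := EVT_min_rV (f := fun v => `|g v|) S0 sphere_compact.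
      by apply: continuous_subspaceT => v;
        exact: (continuous_comp (gcont v) (@norm_continuous _ _ (g v))).
    rewrite inE /= => v01 v0min; exists `|g v0|.
      rewrite normr_gt0; apply/negP => /eqP gv0.
      have v00 : v0 = 0 by apply: (can_inj (@r2vK R H)); rewrite linear0 -gv0.
      by move: v01; rewrite v00 normr0 => /esym/eqP; rewrite oner_eq0.
    move=> v; have [->|vn0] := eqVneq v 0; first by rewrite normr0 mulr0.
    have := v0min (`|v|^-1 *: v); rewrite inE /= => /(_ (unit _ vn0)).
    by rewrite gZ normrZ ger0_norm ?invr_ge0// ler_pdivlMl ?normr_gt0// mulrC.
  exists 1 => // v; have [->|vn0] := eqVneq v 0; first by rewrite normr0 mulr0.
  have : [set v : 'rV[R]_n | `|v| = 1] (`|v|^-1 *: v) by apply: unit.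
  by rewrite S0.
have ball_compact : compact [set v : 'rV[R]_n | `|v| <= M / c].
  apply: bounded_closed_compact.
    exists (M / c); split=> [|r r1 v /= vM]; rewrite ?num_real//.
    by rewrite (le_trans vM)// ltW.
  exact: (@closed_norm_preimage R 'rV[R]_n [set x | x <= M / c]
    (@closed_le _ _)).
apply: subclosed_compact
  (continuous_compact (continuous_subspaceT gcont) ball_compact) _.
  exact: (@closed_norm_preimage R H [set x | x <= M] (@closed_le _ _)).
move=> x /= xM; exists (v2r x); last exact: v2rK.
by rewrite /= ler_pdivlMr// mulrC (le_trans (cg _))// /g v2rK.
Qed.

End dotp_theory.

(** * Limits along cluster points of sequences *)

Lemma cluster_seq {T : topologicalType} (A : set T) (u : nat -> T) :
  compact A -> (forall n, A (u n)) -> exists2 x, A x & cluster (u @ \oo) x.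
Proof.
move=> cA Au; have [|x [Ax ux]] := cA (u @ \oo) _; last by exists x.
exact: (filterE _ Au).
Qed.

(** Passes inequalities with an error of order [1 / n] to a cluster point, without extracting a
    subsequence. *)
Lemma cluster_ge0 {R : realType} {T : topologicalType} (u : nat -> T) x
    (f : T -> R) (K : R) : cluster (u @ \oo) x -> {for x, continuous f} ->
  (forall n, - (K / n.+1%:R) <= f (u n)) -> 0 <= f x.
Proof.
move=> ux fc fu; rewrite leNgt; apply/negP => fx0.
have h : \forall y \near x, f y < f x / 2.
  by apply: (cvgr_lt (f x)) => //; lra.
have : (fun n : nat => - (K / n.+1%:R)) @ \oo --> (0 : R).
  rewrite -oppr0 -[X in - X](mulr0 K); apply: cvgN; apply: cvgMl_tmp.
  exact: cvg_harmonic.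
move=> /(cvgr_gt 0) /(_ (f x / 2)) => /(_ ltac:(lra)) lo.
have : (u @ \oo) [set y | f x / 2 < f y].
  by apply: filterS lo => n /lt_le_trans; apply; exact: fu.
move=> /ux /(_ h) [y [/= ? ?]]; lra.
Qed.

(** * Minty's theorem *)

Section minty.
Context {R : realType} {H : finHilbertType R} (T : H -> set H).

Inductive gph_hull : H -> H -> R -> Prop :=
| gph_hull_gph y w : T y w -> gph_hull y w '[y, w]
| gph_hull_conv t y w s y' w' s' : 0 <= t <= 1 ->
    gph_hull y w s -> gph_hull y' w' s' ->
    gph_hull ((1 - t) *: y + t *: y') ((1 - t) *: w + t *: w')
      ((1 - t) * s + t * s').

Hypothesis Tmono : Defs.monotone T.

(** The inequality is affine in each triple separately, so two inductions reduce it to graph points,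
    where it is monotonicity expanded. *)
Lemma gph_hull_cross y w s y' w' s' : gph_hull y w s -> gph_hull y' w' s' ->
  '[y, w'] + '[y', w] <= s + s'.
Proof.
have base a c b d r : T a c -> gph_hull b d r ->
    '[a, d] + '[b, c] <= '[a, c] + r.
  move=> Tac; elim=> [{}b {}d Tbd|t b1 d1 r1 b2 d2 r2 /andP[t0 t1] _ h1 _ h2].
    by have := Tmono Tac Tbd; rewrite !dotpE; lra.
  rewrite !dotpE.
  by have := @ler_wpM2l _ (1 - t) _ _ _ h1; have := ler_wpM2l t0 h2; nra.
elim=> [{}y {}w Tyw h|t b1 d1 r1 b2 d2 r2 /andP[t0 t1] _ h1 _ h2 h].
  by have := base _ _ _ _ _ Tyw h; lra.
have := ler_wpM2l t0 (h2 h).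
have : (1 - t) * ('[b1, w'] + '[y', d1]) <= (1 - t) * (r1 + s').
  by apply: ler_wpM2l (h1 h); lra.
rewrite !dotpE; lra.
Qed.

Lemma gph_hull_pairing y w s : gph_hull y w s -> '[y, w] <= s.
Proof. by move=> h; have := gph_hull_cross h h; lra. Qed.

(* For [s = '[y, w]], '[x - y, x + w] = |x|^2 - '[x, y - w] - s, whose minimum
   over [x] is [- energy y w s], attained at [center y w]. *)
Let center (y w : H) : H := 2^-1 *: (y - w).
Let energy (y w : H) (s : R) : R := '[center y w, center y w] + s.

Let energy_ge0 y w s : gph_hull y w s -> 0 <= energy y w s.
Proof.
move=> /gph_hull_pairing; have := dotp_ge0 (y + w).
by rewrite /energy /center !dotpE (dotpC w y); lra.
Qed.

(** At a minimizer of [energy] with center [x] and third entry [s], optimality towards [(y, w)]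
    reads [2 * '[x, center y w - x] + '[y, w] - s >= 0], while [energy_ge0] gives [s >= - '[x, x]];
    the sum is the claim. The hull need not be closed, so [x] is a cluster point of centers of
    near-minimizers. *)
Lemma minty0 : exists x, forall y w, T y w -> 0 <= '[x - y, - x - w].
Proof.
have [[y0 [w0 Tyw0]]|noT] := pselect (exists y w, T y w); last first.
  by exists 0 => y w Tyw; case: noT; exists y, w.
pose E := [set e | exists y w s, gph_hull y w s /\ e = energy y w s].
have E0 : lbound E 0 by move=> _ [y [w [s [h ->]]]]; exact: energy_ge0.
have Einf : has_inf E.
  split; last by exists 0.
  by exists (energy y0 w0 '[y0, w0]), y0, w0, '[y0, w0]; split; [left|].
pose m := inf E.
have mle y w s : gph_hull y w s -> m <= energy y w s.
  by move=> h; apply: ge_inf; [exact: Einf.2 | exists y, w, s].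
(* The accuracy is squared so that it still tends to 0 after division by a step [t] of length
   [1 / (n + 1)]. *)
have /choice[p hp] n : exists p : H * H * R,
    gph_hull p.1.1 p.1.2 p.2 /\ energy p.1.1 p.1.2 p.2 <= m + n.+1%:R^-1 ^+ 2.
  have n0 : 0 < n.+1%:R^-1 ^+ 2 :> R by rewrite exprn_gt0// invr_gt0.
  have [_ [y [w [s [h ->]]]] /ltW e] := inf_adherent n0 Einf.
  by exists (y, w, s).
pose x n := center (p n).1.1 (p n).1.2.
have path t n y w s : 0 <= t <= 1 -> gph_hull y w s ->
    m <= energy (p n).1.1 (p n).1.2 (p n).2
      + t * (2 * '[x n, center y w - x n] + s - (p n).2)
      + t ^+ 2 * '[center y w - x n, center y w - x n].
  move=> t01 h; have [pn _] := hp n; have := mle _ _ _ (gph_hull_conv t01 pn h).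
  move=> /le_trans; apply; rewrite le_eqVlt; apply/orP; left; apply/eqP.
  rewrite /energy.
  have -> : center ((1 - t) *: (p n).1.1 + t *: y)
      ((1 - t) *: (p n).1.2 + t *: w)
      = x n + t *: (center y w - x n).
    transitivity ((1 - t) *: x n + t *: center y w); last first.
      by rewrite scalerBl scale1r scalerBr addrAC -addrA.
    rewrite /x /center opprD addrACA -!scalerBr scalerDr !scalerA.
    by rewrite ![2^-1 * _]mulrC.
  rewrite -/(x n); move: (center y w) (x n) => c u.
  by rewrite !dotpE (dotpC c u); ring.
(* Strong convexity: the energy at the midpoint of [p 0] and [p n] is the mean of theirs minus
   [|x 0 - x n|^2 / 4]. It is at least [m] and the mean at most [m + 1], so the centers are within
   distance 2. *)
have [M xM] : exists M, forall n, `|x n| <= M.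
  exists (`|x 0%N| + 2) => n; rewrite -lerBlDl.
  apply: le_trans (lerB_dist _ _) _; rewrite distrC.
  rewrite -(ler_pXn2r (n := 2)) ?nnegrE// -dotpp.
  have [h0 e0] := hp 0%N; have [_ en] := hp n.
  have := path 2^-1 n _ _ _ _ h0.
  have {}en : energy (p n).1.1 (p n).1.2 (p n).2 <= m + 1.
    by rewrite (le_trans en)// lerD2l exprn_ile1// ?invr_ge0// invf_le1// ler1n.
  move: e0 en; rewrite /energy -/(x 0%N) -/(x n) invr1 expr1n.
  move: (x 0%N) (x n) => a b; rewrite !dotpE (dotpC a b) => e0 en.
  have h : 0 <= (2^-1 : R) <= 1 by apply/andP; split; lra.
  by move=> /(_ h); lra.
have := cluster_seq (@closed_ball_compact R H M) xM.
move=> [z _ xz]; exists z => y w Tyw.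
pose c := center y w.
have fE (u : H) : '[u - y, - u - w] = '[y, w] + 2 * '[u, c] - '[u, u].
  by rewrite /c /center !dotpE (dotpC u y); lra.
rewrite fE.
pose f (u : H) : R := '[y, w] + 2 * '[u, c] - '[u, u].
(* Dividing the near-optimality inequality by [t] leaves the error [t * (1 + |c - x n|^2)]. *)
apply: (@cluster_ge0 _ _ _ _ f ((M + `|c|) ^+ 2 + 1)) xz _ _.
  apply: cvgB; first apply: cvgD; first exact: cvg_cst.
    by apply: cvgMl_tmp; apply: dotp_cvg => //; exact: cvg_cst.
  by apply: dotp_cvg.
move=> n; pose t : R := n.+1%:R^-1.
have t0 : 0 < t by rewrite invr_gt0.
have t1 : t <= 1 by rewrite invf_le1// ler1n.
have [pn en] := hp n.
have := path t n _ _ _ _ (gph_hull_gph Tyw); rewrite t1 ltW// => /(_ isT) mle_t.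
have cx : '[c - x n, c - x n] <= (M + `|c|) ^+ 2.
  rewrite dotpp lerXn2r ?nnegrE// ?addr_ge0//; first exact: le_trans (xM n).
  by apply: le_trans (ler_normB _ _) _; rewrite addrC lerD.
have := energy_ge0 pn.
have : 0 <= t * (2 * '[x n, c - x n] + '[y, w] - (p n).2 +
    t * (1 + '[c - x n, c - x n])).
  by move: mle_t en; rewrite -/c -/t; lra.
rewrite pmulr_rge0// /f /energy -/(x n) -[n.+1%:R^-1]/t.
have {fE f cx} := ler_wpM2l (ltW t0) cx; move: (x n) c => a b.
rewrite !dotpE; lra.
Qed.

End minty.

(** Apply [minty0] to the map with values translated by [- v]. For maximal [T] the conclusion puts
    [v - x] in [T x]. *)
Lemma minty {R : realType} {H : finHilbertType R} (T : H -> set H) (v : H) :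
  Defs.monotone T -> exists x, forall y w, T y w -> 0 <= '[x - y, v - x - w].
Proof.
move=> Tmono; pose T' y := [set w | T y (w + v)].
have [x y u w|x hx] := @minty0 _ _ T'.
  move=> Tu Tw; have := Tmono _ _ _ _ Tu Tw.
  by rewrite opprD addrACA subrr addr0.
exists x => y w Tyw; have := hx y (w - v); rewrite /T' /= subrK => /(_ Tyw).
by rewrite opprB addrA (addrC (- x)) addrAC.
Qed.

(** * Recession directions, uniform bounds and the limit of the regularization *)

Lemma dotp_sub_sqr_le {R : realType} {H : finHilbertType R} (x y : H) :
  '[x, y] - '[y, y] <= `|x| ^+ 2.
Proof. by have := dotp_le x y; rewrite dotpp; nra. Qed.

(** With [d = - eps b], the pairing ['[b - b0, d]] equals [eps * ('[b0, b] - '[b, b])]; this bounds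
    it uniformly in [eps] and [b]. *)
Lemma regularization_slack {R : realType} {H : finHilbertType R} (x y : H) eps :
  0 <= eps <= 1 -> eps * ('[x, y] - '[y, y]) <= `|x| ^+ 2.
Proof.
move=> /andP[e0 e1]; rewrite (le_trans (ler_wpM2l e0 (dotp_sub_sqr_le x y)))//.
by rewrite ler_piMl// sqr_ge0.
Qed.

(* [Q a b c d] stands for [(c, d)] in [T(a, b)]. *)
Section completion.
Context {R : realType} {X Y : finHilbertType R} (Q : X -> Y -> X -> Y -> Prop).

Hypothesis Qmono : forall a b c d a' b' c' d', Q a b c d -> Q a' b' c' d' ->
  0 <= '[a - a', c - c'] + '[b - b', d - d'].
Hypothesis Qmax : forall a b c d, (forall a' b' c' d', Q a' b' c' d' ->
  0 <= '[a - a', c - c'] + '[b - b', d - d']) -> Q a b c d.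

(* [r] is a recession direction of every fiber [[set b | Q a b c 0]]. *)
Let recession (r : Y) := forall a b c d, Q a b c d -> '[r, d] <= 0.

(** By maximality the whole ray from [b] in direction [r] stays in the fiber; a point of norm at
    least [N + 1] on it contradicts the bound. *)
Lemma bounded_fiber_recession a b c r : Q a b c 0 ->
  bounded_set [set b | Q a b c 0] -> recession r -> r = 0.
Proof.
move=> Qb [M [_ bndM]] rec; apply/eqP; apply: contraT => r0.
have ray t : 0 <= t -> Q a (b + t *: r) c 0.
  move=> t0; apply: Qmax => a' b' c' d' Q'.
  have := mulr_ge0_le0 t0 (rec _ _ _ _ Q').
  by have := Qmono Qb Q'; rewrite !dotpE; lra.
pose N := `|M| + 1.
have N0 : 0 <= N by rewrite addr_ge0.
have MN : M < N by rewrite (le_lt_trans (ler_norm M))// ltrDl.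
pose t := (N + `|b| + 1) / `|r|.
have t0 : 0 <= t by rewrite divr_ge0// !addr_ge0.
have := bndM _ MN _ (ray t t0) => /= btr.
have : `|t *: r| = N + `|b| + 1.
  by rewrite normrZ ger0_norm// divfK// normr_eq0.
have := ler_normB (b + t *: r) b; rewrite addrAC subrr add0r; lra.
Qed.

Hypothesis recession0 : forall r, recession r -> r = 0.

(** Otherwise some [b] grow without bound; a cluster point [r] of their directions has norm at least
    1, yet dividing monotonicity by [|b|] makes [r] a recession direction. *)
Lemma completion_bound M : exists B, forall eps a b c, 0 <= eps <= 1 ->
  `|a| <= M -> `|c| <= M -> Q a b c (- (eps *: b)) -> `|b| <= B.
Proof.
apply: contrapT => unbounded.
have /choice[p hp] n : exists p : R * X * Y * X, [/\ 0 <= p.1.1.1 <= 1,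
    `|p.1.1.2| <= M, `|p.2| <= M,
    Q p.1.1.2 p.1.2 p.2 (- (p.1.1.1 *: p.1.2)) & n.+1%:R < `|p.1.2|].
  apply: contrapT => none; apply: unbounded; exists n.+1%:R.
  move=> eps a b c e0 aM cM Qb.
  by rewrite leNgt; apply/negP => bn; apply: none; exists (eps, a, b, c).
pose u n := `|(p n).1.2|^-1 *: (p n).1.2.
have pos n : 0 < `|(p n).1.2|.
  by have [_ _ _ _] := hp n; apply: le_lt_trans.
have u1 n : `|u n| = 1.
  by rewrite normrZ ger0_norm ?invr_ge0// mulVf// gt_eqF.
have [|r _ ur] := cluster_seq (u := u) (@closed_ball_compact R Y 1).
  by move=> n /=; rewrite u1.
have r1 : 0 <= `|r| - 1.
  apply: (@cluster_ge0 _ _ u r (fun x => `|x| - 1) 0) => //.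
    apply: cvgB; last exact: cvg_cst.
    exact: norm_continuous.
  by move=> n; rewrite u1 subrr mul0r oppr0.
suff r0 : r = 0 by move: r1; rewrite r0 normr0; lra.
apply: recession0 => a b c d Qd; rewrite -oppr_ge0.
(* [K] bounds ['[b_n, d]]: its terms estimate the pairing in [X], the pairing ['[b, d]] and the
   regularization slack. *)
pose K := (M + `|a|) * (M + `|c|) + `|b| * `|d| + `|b| ^+ 2.
apply: (@cluster_ge0 _ _ u r (fun x => - '[x, d]) K) => //.
  by apply: cvgN; apply: dotp_cvg => //; exact: cvg_cst.
move=> n; rewrite lerN2 dotpZl.
have [/andP[e0 e1] aM cM Qn lenb] := hp n.
have M0 : 0 <= M by exact: le_trans aM.
have K0 : 0 <= K by rewrite !addr_ge0// ?mulr_ge0// ?addr_ge0.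
have leK : '[(p n).1.2, d] <= K.
  have := Qmono Qn Qd.
  have : '[(p n).1.1.2 - a, (p n).2 - c] <= (M + `|a|) * (M + `|c|).
    apply: le_trans (dotp_le _ _) _.
    by apply: ler_pM => //; apply: le_trans (ler_normB _ _) _; rewrite lerD2r.
  have := dotp_le b d; rewrite /K.
  have := regularization_slack b (p n).1.2 (eps := (p n).1.1.1).
  rewrite e0 e1 => /(_ isT).
  move: ('[_ - a, _]) => s; rewrite !dotpE; lra.
apply: (le_trans (y := K / `|(p n).1.2|)).
  by rewrite mulrC ler_wpM2r ?invr_ge0.
by rewrite ler_wpM2l// lef_pV2 ?posrE// ltW.
Qed.

Lemma projected_resolvent (a0 : X) (b0 : Y) (c0 v : X) :
  (forall eps v, 0 < eps -> exists a b, Q a b (v - a) (- (eps *: b))) ->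
  Q a0 b0 c0 0 -> exists a b, Q a b (v - a) 0.
Proof.
move=> reg Q0.
have /choice[p hp] n : exists p : X * Y,
    Q p.1 p.2 (v - p.1) (- (n.+1%:R^-1 *: p.2)).
  have [|a [b Qab]] := reg n.+1%:R^-1 v; first by rewrite invr_gt0.
  by exists (a, b).
have eps01 n : 0 <= (n.+1%:R^-1 : R) <= 1.
  by rewrite invr_ge0 ler0n invf_le1// ler1n.
pose c1 := v - a0 - c0.
(* [M] must bound both [a] and [v - a], as [completion_bound] takes one constant for both. *)
pose M := `|a0| + (`|c1| + `|b0|) + `|v|.
(* For [x = a - a0], monotonicity against [Q0] gives [|x|^2 <= |x| |c1| + |b0|^2], hence
   [|x| <= |c1| + |b0|]. *)
have pM0 n : `|(p n).1| <= `|a0| + (`|c1| + `|b0|).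
  rewrite -[X in `|X| <= _](subrK a0) addrC (le_trans (ler_normD _ _))// lerD2l.
  have := regularization_slack b0 (p n).2 (eps01 n).
  have := Qmono (hp n) Q0.
  have -> : v - (p n).1 - c0 = c1 - ((p n).1 - a0).
    by rewrite /c1 opprB [RHS]addrAC addrA subrK.
  move: ((p n).1 - a0) => x; rewrite subr0 => h1 h2.
  rewrite leNgt; apply/negP => lex.
  have := dotp_le x c1.
  have x0 : 0 < `|x| by apply: le_lt_trans lex; rewrite addr_ge0.
  have : (`|c1| + `|b0|) * `|x| < `|x| ^+ 2 by rewrite expr2 ltr_pM2r.
  have : `|b0| ^+ 2 <= `|b0| * `|x|.
    by rewrite expr2 ler_wpM2l// (le_trans _ (ltW lex))// lerDr.
  by move: h1 h2; move: (n.+1%:R^-1) => eps; rewrite !dotpE (dotpp x); lra.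
have pM n : `|(p n).1| <= M by rewrite (le_trans (pM0 n))// lerDl.
have vpM n : `|v - (p n).1| <= M.
  by rewrite (le_trans (ler_normB _ _))// addrC lerD2r.
have [B hB] := completion_bound M.
have pB n : `|(p n).2| <= B by apply: hB (eps01 n) (pM n) (vpM n) (hp n).
have cK := compact_setX
  (@closed_ball_compact R X M) (@closed_ball_compact R Y B).
have [|q _ pq] := cluster_seq (u := p) cK.
  by move=> n; split; [exact: pM|exact: pB].
exists q.1, q.2; apply: Qmax => a b c d Qd.
pose f (x : X * Y) := '[x.1 - a, v - x.1 - c] + '[x.2 - b, 0 - d].
(* Replacing [- eps b_n] by 0 in the pairing costs at most [eps * |b|^2]. *)
apply: (@cluster_ge0 _ _ p q f (`|b| ^+ 2)) => //.
  apply: cvgD; apply: dotp_cvg; apply: cvgB; try exact: cvg_cst.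
  - exact: cvg_fst.
  - by apply: cvgB; [exact: cvg_cst|exact: cvg_fst].
  - exact: cvg_snd.
move=> n; have := Qmono (hp n) Qd.
have /andP[/ler_wpM2l/(_ _ _ (dotp_sub_sqr_le b (p n).2)) + _] := eps01 n.
rewrite /f; move: ('[_ - a, _]) (n.+1%:R^-1) => s eps; rewrite !dotpE; lra.
Qed.

End completion.

(** * Maximality and the orthogonal decomposition *)

(** Adjoining [(x, u)] to the graph keeps it monotone, so maximality forces the point to be there
    already. *)
Lemma maximal_monotone_mem {R : realType} {H : finHilbertType R}
    (T : H -> set H) x u :
  maximal_monotone T -> (forall y v, T y v -> 0 <= '[x - y, u - v]) -> T x u.
Proof.
move=> [Tmono Tmax] xu; pose S y := [set v | T y v \/ (y = x /\ v = u)].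
have Smono : Defs.monotone S.
  move=> y z v w [Tv|[-> ->]] [Tw|[-> ->]].
  - exact: Tmono.
  - by have := xu _ _ Tv; rewrite -(opprB y x) -(opprB v u) dotpNl dotpNr opprK.
  - exact: xu.
  - by rewrite subrr dotp0l.
have /seteqP[+ _] := Tmax S Smono (fun p Tp => or_introl Tp).
by move=> /(_ (x, u)); apply; right.
Qed.

Lemma nbhs_norm_lt {R : realType} {V : normedModType R} (x : V) (M : R) :
  `|x| < M -> nbhs x [set y | `|y| < M].
Proof. exact: (@cvgr_norm_lt _ _ _ (nbhs x) _ id x (@cvg_id _ _)). Qed.

Lemma closed_dotp_halfspace {R : realType} {H : finHilbertType R}
    (y z : H) (r : R) :
  closed [set x | 0 <= r + '[x - y, z]].
Proof.
have dc : continuous (fun x => '[x, z]).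
  by move=> x; apply: dotp_cvg; [exact: cvg_id|exact: cvg_cst].
have := proj1 (continuous_closedP _) dc _ (@closed_ge _ ('[y, z] - r)).
congr closed; apply/funext => x /=; apply/propext.
by rewrite !dotpE; split; lra.
Qed.

Lemma rescaled_dotp {R : realType} {H : finHilbertType R} (x y z : H) (s : R) :
  s != 0 -> '[x - s *: y, 0 - x - s^-1 *: z] =
    '[s^-1 *: x - y, - (s * s *: (s^-1 *: x)) - z].
Proof. by move=> s0; rewrite !dotpE; field. Qed.

Section decomposition.
Context {R : realType} {H : finHilbertType R} (U V : {vspace H}).
Hypothesis UV : orthogonal_decomposition U V.
Implicit Types (a c : subvs_of U) (b d : subvs_of V).

Lemma dotp_of_components a b c d :
  '[of_components a b, of_components c d] = '[a, c] + '[b, d].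
Proof.
have orth x y : '[vsval (x : subvs_of U), vsval (y : subvs_of V)] = 0.
  by apply: UV.1; exact: subvsP.
by rewrite /of_components !dotpE orth (dotpC (vsval b)) orth addr0 add0r.
Qed.

Lemma of_componentsB a b c d :
  of_components a b - of_components c d = of_components (a - c) (b - d).
Proof. by rewrite /of_components !linearB /= opprD addrACA. Qed.

Lemma of_components_surj (x : H) : exists a b, x = of_components a b.
Proof.
have : x \in (U + V)%VS by rewrite UV.2 memvf.
move=> /memv_addP[u uU [v vV ->]].
by exists (Subvs uU), (Subvs vV).
Qed.

(** The rescaling preserves pairings, so Minty applies to [T'] at [(v, 0)]. Its second component,
    [s^-1 d = - s b], becomes [d = - eps b]; maximality of [T] turns the inequality into
    membership. *)
Lemma regularized_resolvent (T : H -> set H) eps v : maximal_monotone T ->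
  0 < eps -> exists a b,
    T (of_components a b) (of_components (v - a) (- (eps *: b))).
Proof.
move=> Tmax eps0; pose s := Num.sqrt eps.
have s0 : s != 0 by rewrite gt_eqF// sqrtr_gt0.
have ss : s * s = eps by rewrite -expr2 sqr_sqrtr// ltW.
(* Rescaling the [V] components by [s] turns the weight [eps] into [1]. *)
pose T' x := [set u | exists a b c d, [/\ x = of_components a (s *: b),
  u = of_components c (s^-1 *: d) & T (of_components a b) (of_components c d)]].
have T'mono : Defs.monotone T'.
  move=> x y u w [a [b [c [d [-> -> Tabcd]]]]].
  move=> [a' [b' [c' [d' [-> -> Tabcd']]]]].
  have := Tmax.1 _ _ _ _ Tabcd Tabcd'.
  rewrite !of_componentsB !dotp_of_components -!scalerBr dotpZl dotpZr.
  by rewrite mulrA mulfV// mul1r.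
have [x hx] := minty (of_components v (0 : subvs_of V)) T'mono.
have [a [b xab]] := of_components_surj x.
exists a, (s^-1 *: b); apply: (@maximal_monotone_mem _ H T _ _ Tmax) => y w Tyw.
have [a' [b' yE]] := of_components_surj y.
have [c' [d' wE]] := of_components_surj w.
have := hx (of_components a' (s *: b')) (of_components c' (s^-1 *: d')) _.
rewrite xab yE wE !of_componentsB !dotp_of_components.
rewrite rescaled_dotp// ss; apply.
by exists a', b', c', d'; rewrite -yE -wE.
Qed.

End decomposition.

(** * Compact convex fibers, local boundedness and maximality *)

Theorem theorem3p6 (R : realType) (H : finHilbertType R)
    (Hs Hss : {vspace H}) (Hdec : orthogonal_decomposition Hs Hss)
    (T : H -> set H) (Tmax : maximal_monotone T)
    (Tbnd : exists zbar wbar : subvs_of Hs,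
      gph (projected_map Hs Hss T) (zbar, wbar) /\
      bounded_set (completion_map Hs Hss T (zbar, wbar))) :
  [/\ forall zs ws : subvs_of Hs,
        gph (projected_map Hs Hss T) (zs, ws) ->
        [/\ completion_map Hs Hss T (zs, ws) !=set0,
            compact (completion_map Hs Hss T (zs, ws)) &
            convex_set (completion_map Hs Hss T (zs, ws))],
      locally_bounded_on_dom (completion_map Hs Hss T) &
      maximal_monotone (projected_map Hs Hss T)].
Proof.
pose Q (a : subvs_of Hs) (b : subvs_of Hss) (c : subvs_of Hs)
    (d : subvs_of Hss) :=
  T (of_components a b) (of_components c d).
have Qmono a b c d a' b' c' d' : Q a b c d -> Q a' b' c' d' ->
    0 <= '[a - a', c - c'] + '[b - b', d - d'].
  by move=> h h'; have := Tmax.1 _ _ _ _ h h';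
     rewrite !of_componentsB (dotp_of_components Hdec).
have Qmax a b c d : (forall a' b' c' d', Q a' b' c' d' ->
    0 <= '[a - a', c - c'] + '[b - b', d - d']) -> Q a b c d.
  move=> h; rewrite /Q; apply: (@maximal_monotone_mem _ H T _ _ Tmax) => y w.
  have [a' [b' ->]] := of_components_surj Hdec y.
  have [c' [d' ->]] := of_components_surj Hdec w.
  by rewrite !of_componentsB (dotp_of_components Hdec); exact: h.
have [a0 [c0 [[b0 Q0] bnd0]]] := Tbnd.
have rec0 := bounded_fiber_recession Qmono Qmax Q0 bnd0.
have bound := completion_bound Qmono rec0.
have fiber_bound M : exists B, forall a b c, `|a| <= M -> `|c| <= M ->
    Q a b c 0 -> `|b| <= B.
  have [B hB] := bound M; exists B => a b c aM cM Qb.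
  by apply: (hB 0 a b c) => //; rewrite ?lexx ?ler01// scale0r oppr0.
split.
- move=> a c [b Qb]; split; first by exists b.
  + have [B hB] := fiber_bound (Num.max `|a| `|c|).
    apply: subclosed_compact (@closed_ball_compact _ _ B) _; last first.
      by move=> b' /hB; apply; rewrite le_max lexx ?orbT.
    (* By maximality the fiber is an intersection of closed sets, each given by one affine
       inequality in [b] per graph point. *)
    have -> : completion_map Hs Hss T (a, c) =
        \bigcap_(p in [set p | Q p.1.1 p.1.2 p.2.1 p.2.2])
        [set b | 0 <= '[a - p.1.1, c - p.2.1] + '[b - p.1.2, 0 - p.2.2]].
      apply/seteqP; split => [b' Qb' p /= Qp|b' /= h]; first exact: Qmono.
      by apply: Qmax => a1 b1 c1 d1 Q1; exact: (h ((a1, b1), (c1, d1))).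
    apply: closed_bigI => p _.
    exact: closed_dotp_halfspace.
  + move=> x y t /=; rewrite !inE /= => Qx Qy.
    apply: Qmax => a' b' c' d' Q'.
    have := Qmono _ _ _ _ _ _ _ _ Qx Q'; have := Qmono _ _ _ _ _ _ _ _ Qy Q'.
    move: ('[a - a', c - c']) => r hy hx.
    have tE : conv t x y =
        t%:num *: (x : subvs_of Hss) + (1 - t%:num) *: y by [].
    have t0 : 0 <= t%:num by []. have t1 : t%:num <= 1 by [].
    rewrite tE; move: x y hx hy {Qx Qy tE} => x y hx hy.
    rewrite (_ : _ + _ = t%:num * (r + '[(x : subvs_of Hss) - b', 0 - d']) +
      (1 - t%:num) * (r + '[(y : subvs_of Hss) - b', 0 - d'])).
      by rewrite addr_ge0// mulr_ge0// subr_ge0.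
    by rewrite !dotpE; ring.
(* The added 1 leaves room for a neighborhood of [(a, c)]. *)
- move=> [a c] _; pose M := Num.max `|a| `|c| + 1.
  have [B hB] := fiber_bound M.
  exists [set p | `|p.1| <= M /\ `|p.2| <= M].
    exists ([set a' | `|a'| < M], [set c' | `|c'| < M]) => /=.
      have ltM e : e <= Num.max `|a| `|c| -> e < M.
        by move=> /le_lt_trans; apply; rewrite ltrDl.
      split; apply: nbhs_norm_lt; apply: ltM.
        by rewrite le_max lexx.
      by rewrite le_max lexx orbT.
    by move=> [a' c'] [/= ? ?]; split; exact: ltW.
  exists B; split; first exact: num_real.
  move=> r rB b [[a' c'] [[/= aM cM] _] Qb].
  by apply: le_trans (ltW rB); exact: hB Qb.
- have Pmono : Defs.monotone (projected_map Hs Hss T).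
    move=> a a' c c' [b Qb] [b' Qb'].
    by have := Qmono _ _ _ _ _ _ _ _ Qb Qb'; rewrite subrr dotp0r addr0.
  split=> // S Smono PS; apply/seteqP; split=> // -[a c] Sac.
  have reg eps v : 0 < eps -> exists a b, Q a b (v - a) (- (eps *: b)).
    exact: regularized_resolvent.
  (* Solving at [a + c] gives [a'] with [a + c - a'] in its image. Monotonicity of [S] then yields
     [- |a - a'|^2 >= 0], so [a' = a] and the image point is [c]. *)
  have [a' [b' Q']] := projected_resolvent Qmono Qmax rec0 (a + c) reg Q0.
  have Sa' : S a' (a + c - a') by apply: (PS (a', a + c - a')); exists b'.
  have := Smono _ _ _ _ Sac Sa'.
  have -> : c - (a + c - a') = - (a - a').
    by rewrite !opprB addrCA opprD [- a - c]addrC [X in _ + X]addrA subrr add0r.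
  rewrite dotpNr oppr_ge0 dotpp => le0.
  have /eqP : `|a - a'| ^+ 2 = 0 by apply: le_anti; rewrite le0 sqr_ge0.
  rewrite sqrf_eq0 normr_eq0 subr_eq0 => /eqP aa'.
  by exists b'; rewrite aa' in Q' *; move: Q'; rewrite [a' + c]addrC addrK.
Qed.
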